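(* For any $q,r\ge0$, the set $$N_{q,r}=\{(a_1,a_2,a_3)\in\mathfrak{su}(2)^3:\ \langle a_1,[a_2,a_3]\rangle<0,\ \langle a_i,a_j\rangle=0\ \forall i\ne j,\ \langle a_1,a_1\rangle-\langle a_2,a_2\rangle=q,\ \langle a_2,a_2\rangle-\langle a_3,a_3\rangle=r\}$$ is diffeomorphic to $\mathbb{R}_{>0}\times\mathrm{SO}(3)$, and thus connected.
   Context: $\langle\cdot,\cdot\rangle$ is the positive definite Ad-invariant inner product on $\mathfrak{su}(2)$ normalized so that $(\mathfrak{su}(2),[\cdot,\cdot],\langle\cdot,\cdot\rangle)\cong(\mathbb{R}^3,\times,\cdot)$, i.e. $\langle x,y\rangle=-2\operatorname{tr}(xy)$. The set $N_{q,r}$ carries the structure of an embedded $4$-dimensional submanifold of the open set $\{\langle a_1,[a_2,a_3]\rangle\neq0\}\subset\mathfrak{su}(2)^3$. *)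

(* Defs.v *)
From HB Require Import structures.
From mathcomp Require Import all_boot all_order all_algebra.
From mathcomp Require Import all_classical all_reals all_analysis.
From mathcomp Require Import complex.
From mathcomp Require Import ring lra.

Set Implicit Arguments.
Unset Strict Implicit.
Unset Printing Implicit Defensive.

Import Order.TTheory GRing.Theory Num.Theory.
Import numFieldNormedType.Exports.

Local Open Scope classical_set_scope.
Local Open Scope complex_scope.
Local Open Scope sesquilinear_scope.
Local Open Scope ring_scope.

(* Meant for finite-dimensional V and an open set U: there, f is C^(k+1) iff
   it is differentiable and all its directional derivatives are C^k. *)
Fixpoint Ck_on (R : realType) (V W : normedModType R) (k : nat) (U : set V)
    (f : V -> W) : Prop :=
  match k with
  | 0 => forall x, U x -> {for x, continuous f}
  | k'.+1 => (forall x, U x -> differentiable f x) /\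
             (forall v : V, Ck_on k' U ('D_v f))
  end.

Definition smooth_on (R : realType) (V W : normedModType R) (U : set V)
    (f : V -> W) : Prop := forall k, Ck_on k U f.

(* A map between subsets of vector spaces is smooth when it extends, around
   each point, to a smooth map on an open set of the ambient space.  On embedded
   submanifolds this is smoothness for the induced manifold structures. *)
Definition smooth_map (R : realType) (V W : normedModType R) (A : set V)
    (f : V -> W) : Prop :=
  forall x, A x -> exists (U : set V) (F : V -> W),
    [/\ open U, U x, smooth_on U F & forall y, A y -> U y -> F y = f y].

Definition diffeomorphic (R : realType) (V W : normedModType R)
    (A : set V) (B : set W) : Prop :=
  exists (f : V -> W) (g : W -> V),
    [/\ set_bij A B f, {in A, cancel f g}, smooth_map A f & smooth_map B g].

Definition SO3 (R : realType) : set 'M[R]_3 :=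
  [set Q | Q *m Q^T = 1%:M /\ \det Q = 1].

Arguments SO3 R _ : clear implicits.

Definition su2_pred (R : realType) : {pred 'M[R[i]]_2} :=
  [pred x : 'M[R[i]]_2 | (x ^t* == - x) && (\tr x == 0)].

Arguments su2_pred R _ : clear implicits.

Record su2 (R : realType) :=
  Su2 { su2_val :> 'M[R[i]]_2; su2_valP : su2_val \in su2_pred R }.

HB.instance Definition _ (R : realType) := [isSub for @su2_val R].
HB.instance Definition _ (R : realType) := [Choice of su2 R by <:].

Fact su2_zmod_closed (R : realType) : zmod_closed (su2_pred R).
Proof.
split=> [|x y]; rewrite !inE.
  by rewrite trmx0 map_mx0 oppr0 mxtrace0 !eqxx.
move=> /andP[/eqP xH /eqP x0] /andP[/eqP yH /eqP y0].
by rewrite [(x - y)^T]linearB [\tr _]linearB /= map_mxB xH yH x0 y0 subr0 opprK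
  opprB addrC !eqxx.
Qed.

HB.instance Definition _ (R : realType) :=
  GRing.isZmodClosed.Build _ (su2_pred R) (su2_zmod_closed R).
HB.instance Definition _ (R : realType) := [SubChoice_isSubZmodule of su2 R by <:].

Fact su2_scale_subproof (R : realType) (a : R) (x : su2 R) :
  a%:C *: su2_val x \in su2_pred R.
Proof.
have := su2_valP x; rewrite !inE => /andP[/eqP xH /eqP x0].
rewrite [_^T]linearZ [\tr _]linearZ /= map_mxZ xH x0 mulr0 eqxx andbT scalerN.
by rewrite [_ (a%:C)]conjc_real eqxx.
Qed.

Definition su2_scale (R : realType) (a : R) (x : su2 R) : su2 R :=
  Su2 (su2_scale_subproof a x).

Section su2_lmodule.
Variable R : realType.

Fact su2_scaleA (a b : R) (x : su2 R) :
  su2_scale a (su2_scale b x) = su2_scale (a * b) x.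
Proof. by apply: val_inj; rewrite /= scalerA rmorphM. Qed.

Fact su2_scale1 : left_id 1 (@su2_scale R).
Proof. by move=> x; apply: val_inj; rewrite /= scale1r. Qed.

Fact su2_scaleDr : right_distributive (@su2_scale R) +%R.
Proof. by move=> a x y; apply: val_inj; rewrite /= scalerDr. Qed.

Fact su2_scaleDl (x : su2 R) : {morph (@su2_scale R)^~ x : a b / a + b}.
Proof. by move=> a b; apply: val_inj; rewrite /= rmorphD scalerDl. Qed.

HB.instance Definition _ := GRing.Zmodule_isLmodule.Build R (su2 R)
  su2_scaleA su2_scale1 su2_scaleDr su2_scaleDl.

End su2_lmodule.

Fact su2_bracket_subproof (R : realType) (x y : su2 R) :
  su2_val x *m su2_val y - su2_val y *m su2_val x \in su2_pred R.
Proof.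
have := su2_valP x; rewrite !inE => /andP[/eqP xH _].
have := su2_valP y; rewrite !inE => /andP[/eqP yH _].
rewrite [_^T]linearB [\tr _]linearB /= map_mxB !trmx_mul !map_mxM xH yH !mulNmx !mulmxN !opprK.
by rewrite opprB mxtrace_mulC subrr !eqxx.
Qed.

Definition su2_bracket (R : realType) (x y : su2 R) : su2 R :=
  Su2 (su2_bracket_subproof x y).

(* -2 tr(xy) is real on su(2), see su2_innerE. *)
Definition su2_inner (R : realType) (x y : su2 R) : R :=
  complex.Re (- 2 * \tr (su2_val x *m su2_val y)).

Section su2_norm.
Variable R : realType.
Implicit Types x y : su2 R.

Definition su2_ca x := complex.Im (su2_val x 0 0).
Definition su2_cb x := complex.Re (su2_val x 0 1).
Definition su2_cc x := complex.Im (su2_val x 0 1).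

Fact su2_entries x :
  [/\ su2_val x 0 0 = 0 +i* su2_ca x, su2_val x 0 1 = su2_cb x +i* su2_cc x,
      su2_val x 1 0 = - su2_cb x +i* su2_cc x & su2_val x 1 1 = 0 +i* - su2_ca x].
Proof.
have := su2_valP x; rewrite !inE => /andP[/eqP/matrixP xH /eqP].
rewrite /mxtrace !big_ord_recl big_ord0 addr0 /su2_ca /su2_cb /su2_cc.
have -> : lift ord0 (ord0 : 'I_1) = 1 :> 'I_2 by apply: val_inj.
have := xH 0 0; have := xH 0 1; rewrite !mxE.
case: (su2_val x 0 0) => a a'; case: (su2_val x 0 1) => b b'.
case: (su2_val x 1 0) => c c'; case: (su2_val x 1 1) => d d' /=.
move=> /eqP; rewrite eq_complex => /andP[/eqP/= h1 /eqP/= h2].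
move=> /eqP; rewrite eq_complex => /andP[/eqP/= h3 _].
move=> /eqP; rewrite eq_complex => /andP[/eqP/= h4 /eqP/= h5].
by split=> //; apply/eqP; rewrite eq_complex /=; apply/andP; split; apply/eqP; lra.
Qed.

Lemma su2_innerE x y :
  (su2_inner x y)%:C = - 2 * \tr (su2_val x *m su2_val y).
Proof.
rewrite /su2_inner /mxtrace !big_ord_recl big_ord0 addr0 !mxE.
rewrite !big_ord_recl !big_ord0 !addr0.
have -> : lift ord0 (ord0 : 'I_1) = 1 :> 'I_2 by apply: val_inj.
have [-> -> -> ->] := su2_entries x; have [-> -> -> ->] := su2_entries y.
by apply/eqP; rewrite eq_complex /=; apply/andP; split; apply/eqP; ring.
Qed.

Fact su2_inner_coord x y :
  su2_inner x y = 4 * (su2_ca x * su2_ca y + su2_cb x * su2_cb y + su2_cc x * su2_cc y).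
Proof.
rewrite /su2_inner /mxtrace !big_ord_recl big_ord0 addr0 !mxE.
rewrite !big_ord_recl !big_ord0 !addr0.
have -> : lift ord0 (ord0 : 'I_1) = 1 :> 'I_2 by apply: val_inj.
have [-> -> -> ->] := su2_entries x; have [-> -> -> ->] := su2_entries y.
rewrite /=; ring.
Qed.

Definition su2_norm x : R := Num.sqrt (su2_inner x x).

Fact su2_inner_ge0 x : 0 <= su2_inner x x.
Proof. rewrite su2_inner_coord; nra. Qed.

Fact su2_normD x y : su2_norm (x + y) <= su2_norm x + su2_norm y.
Proof.
have nD0 : 0 <= su2_norm x + su2_norm y by rewrite addr_ge0 ?sqrtr_ge0.
rewrite -(ler_sqr (sqrtr_ge0 _) nD0) sqrrD !sqr_sqrtr ?su2_inner_ge0//.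
have cD u v : (su2_ca (u + v) = su2_ca u + su2_ca v) * (su2_cb (u + v) = su2_cb u + su2_cb v) *
    (su2_cc (u + v) = su2_cc u + su2_cc v).
  by rewrite /su2_ca /su2_cb /su2_cc /= !mxE !raddfD.
have -> : su2_inner (x + y) (x + y) =
    su2_inner x x + 2 * su2_inner x y + su2_inner y y.
  by rewrite !su2_inner_coord !cD; ring.
rewrite lerD2r lerD2l mulr_natl ler_wMn2r// (le_trans (ler_norm _))//.
rewrite -ler_sqr ?nnegrE ?mulr_ge0 ?sqrtr_ge0//.
rewrite exprMn !sqr_sqrtr ?su2_inner_ge0// real_normK ?num_real// !su2_inner_coord.
rewrite -subr_ge0 (_ : _ - _ = 16 * ((su2_ca x * su2_cb y - su2_cb x * su2_ca y) ^+ 2 +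
  (su2_ca x * su2_cc y - su2_cc x * su2_ca y) ^+ 2 + (su2_cb x * su2_cc y - su2_cc x * su2_cb y) ^+ 2)).
  by rewrite mulr_ge0// !addr_ge0 ?sqr_ge0.
by ring.
Qed.

Fact su2_normZ (a : R) x : su2_norm (a *: x) = `|a| * su2_norm x.
Proof.
have cZ : (su2_ca (a *: x) = a * su2_ca x) * (su2_cb (a *: x) = a * su2_cb x) *
    (su2_cc (a *: x) = a * su2_cc x).
  rewrite /su2_ca /su2_cb /su2_cc /= !mxE.
  by case: (su2_val x 0 0) => ? ?; case: (su2_val x 0 1) => ? ? /=;
    do !split; rewrite /=; ring.
rewrite /su2_norm -sqrtr_sqr -sqrtrM ?sqr_ge0//; congr Num.sqrt.
by rewrite !su2_inner_coord !cZ; ring.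
Qed.

Fact su2_norm0_eq0 x : su2_norm x = 0 -> x = 0.
Proof.
move=> /eqP; rewrite sqrtr_eq0 su2_inner_coord => le0.
have a0 : su2_ca x = 0 by nra.
have b0 : su2_cb x = 0 by nra.
have c0 : su2_cc x = 0 by nra.
apply: val_inj; apply/matrixP => i j; rewrite /= mxE.
have [] := su2_entries x; rewrite a0 b0 c0 !oppr0.
have or2 (k : 'I_2) : k = 0 \/ k = 1.
  by case: k => [[|[|//]] k2]; [left|right]; apply: val_inj.
by case: (or2 i) => ->; case: (or2 j) => ->.
Qed.

HB.instance Definition _ :=
  Lmodule_isNormed.Build R (su2 R) su2_normD su2_normZ su2_norm0_eq0.

End su2_norm.

Definition Nqr (R : realType) (q r : R) : set (su2 R * su2 R * su2 R) :=
  [set a | let: (a1, a2, a3) := a in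
    [/\ su2_inner a1 (su2_bracket a2 a3) < 0,
        forall i j : 'I_3, i != j ->
          su2_inner (tnth [tuple a1; a2; a3] i) (tnth [tuple a1; a2; a3] j) = 0,
        su2_inner a1 a1 - su2_inner a2 a2 = q
      & su2_inner a2 a2 - su2_inner a3 a3 = r]].

(* Main.v *)
Require Import Defs.
From mathcomp Require Import all_boot all_order all_algebra.
From mathcomp Require Import all_classical all_reals all_analysis.
From HB Require Import structures.
From mathcomp Require Import complex.
From mathcomp Require Import ring lra.
Import Order.TTheory GRing.Theory Num.Theory.
Import numFieldNormedType.Exports.
Local Open Scope classical_set_scope.
Local Open Scope ring_scope.
Set Implicit Arguments.
Unset Strict Implicit.
Unset Printing Implicit Defensive.

(** A triple in su(2) is the same as a real 3 x 3 matrix M, whose rows are the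
coordinates of the a_i in an orthonormal basis.  The inner products of the
triple are the entries of M M^T and its triple product is det M, so N_{q,r} is
the set of M with det M < 0 and M M^T = diag(t + r + q, t + r, t), where
t = |a_3|^2 ([Nqr_frame]).  There t > 0, since t = 0 would make det M vanish;
as q, r >= 0, all three diagonal entries are then positive.  Dividing each row
by its length, and changing its sign to correct the orientation, gives a matrix
Q in SO(3), and (t, Q) determines M: the inverse map multiplies the rows of Q by
minus the square roots of t + r + q, t + r and t.

Both maps are built from linear maps, products and the functions s^(1/2) and
s^(-1/2) with s > 0.  They are smooth because the derivative of s^(-1/2) is a
polynomial in s^(-1/2) itself, so that induction on the order of
differentiability closes up ([Ck_on_rsqrt]).

Connectedness is transported from R_{>0} x SO(3).  There, every point is joined
to (1, 1): Q is a product of three rotations about coordinate axes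
([SO3_euler]), and the three angles can be scaled down to 0 while t moves along
t^s. *)

(** * Calculus of smooth functions *)

Section Smooth.
Variables (R : realType) (V W : normedModType R).
Implicit Types (U : set V) (f g : V -> W).

(** The difference [g - f] vanishes near [x], hence has differential 0 there. *)
Lemma near_differentiable_eq f g (x : V) :
  (\near x, f x = g x) -> differentiable f x -> differentiable g x.
Proof.
move=> fg df; rewrite -[g](subrKC f); apply: differentiableD => //.
have h0 : \near x, (g - f) x = 0.
  by apply: filterS fg => y fgy; rewrite -[LHS]/(g y - f y) fgy subrr.
have loc : (g - f) \o shift x = cst ((g - f) x) + (\0 : V -> W) +o_ 0 id.
  apply/eqaddoP => _/posnumP[e].
  rewrite (nbhs_singleton h0).
  have : \forall y \near 0, (g - f) (y + x) = 0.
    by rewrite (near_shift x) /= sub0r; apply: filterS h0 => y /=; rewrite addrNK.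
  apply: filterS => y /= hy.
  rewrite -[_ y]/((g - f) (y + x) - (0 + 0)) hy addr0 subr0 normr0.
  by rewrite mulr_ge0.
apply/diff_locallyP.
have -> : 'd (g - f) x = (\0 : V -> W) :> (V -> W).
  by apply: diff_unique => //; exact: cst_continuous.
by split => //; exact: cst_continuous.
Qed.

(** The usual rules of differentiation hold only at the points of [U], so the
derivatives they give must be allowed to differ outside [U]. *)
Lemma eq_Ck_on k U f g : open U -> (forall x, U x -> f x = g x) ->
  Ck_on k U f -> Ck_on k U g.
Proof.
move=> Uo; elim: k f g => [|k IH] f g fg /=.
  move=> fc x Ux; suff : g @ x --> f x by rewrite fg.
  apply: cvg_trans (fc _ Ux); apply: near_eq_cvg.
  by near=> y; apply: fg; near: y; exact: open_nbhs_nbhs.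
have nfg x : U x -> \near x, f x = g x.
  by move=> Ux; near=> y; apply: fg; near: y; exact: open_nbhs_nbhs.
move=> [df Df]; split=> [x Ux|v].
  by apply: near_differentiable_eq (df _ Ux); exact: nfg.
by apply: IH (Df v) => x Ux; apply: near_eq_derive; exact: nfg.
Unshelve. all: by end_near. Qed.

Lemma Ck_onS k U f : Ck_on k.+1 U f -> Ck_on k U f.
Proof.
elim: k f => [|k IH] f [df Df].
  by move=> x /df; exact: differentiable_continuous.
by split=> // v; exact/IH.
Qed.

Lemma Ck_on_cst k U (w : W) : Ck_on k U (cst w).
Proof.
elim: k w => [|k IH] w /=; first by move=> x _; exact: cst_continuous.
split=> [x _|v]; first exact: differentiable_cst.
rewrite (_ : 'D_v _ = cst 0) //; apply/funext => x; exact: derive_cst.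
Qed.

Lemma smooth_on_linear U f : linear f -> continuous f -> smooth_on U f.
Proof.
move=> f_lin; pose fL : {linear V -> W} :=
  HB.pack f (GRing.isLinear.Build _ _ _ _ _ f_lin).
move=> fc; have df x : differentiable f x.
  exact: (@linear_differentiable _ _ _ fL).
case=> [|k]; first by move=> x _; exact: fc.
split=> // v; rewrite (_ : 'D_v f = cst (f v)); first exact: Ck_on_cst.
by apply/funext => x; rewrite deriveE // (@diff_lin _ _ _ fL).
Qed.

Lemma Ck_onD k U f g : open U -> Ck_on k U f -> Ck_on k U g ->
  Ck_on k U (fun x => f x + g x).
Proof.
move=> Uo; elim: k f g => [|k IH] f g /=.
  by move=> fc gc x Ux; apply: continuousD; [exact: fc|exact: gc].
move=> [df Df] [dg Dg]; split=> [x Ux|v].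
  by apply: differentiableD; [exact: df|exact: dg].
apply: eq_Ck_on (IH _ _ (Df v) (Dg v)) => // x Ux; symmetry.
by apply: deriveD; apply: diff_derivable; [exact: df|exact: dg].
Qed.

End Smooth.

Section SmoothScalar.
Variables (R : realType) (V : normedModType R).
Implicit Types (U : set V) (p q : V -> R).

Lemma Ck_onM k U p q : open U -> Ck_on k U p -> Ck_on k U q ->
  Ck_on k U (fun x => p x * q x).
Proof.
move=> Uo; elim: k p q => [|k IH] p q.
  by move=> fc gc x Ux; apply: continuousM; [exact: fc|exact: gc].
move=> pC qC; have [dp Dp] := pC; have [dq Dq] := qC.
split=> [x Ux|v].
  by apply: differentiableM; [exact: dp|exact: dq].
apply: (@eq_Ck_on _ _ _ _ _ (fun x => p x * 'D_v q x + q x * 'D_v p x)) => // [x Ux|].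
  symmetry; apply: deriveM; apply: diff_derivable; [exact: dp|exact: dq].
by apply: Ck_onD => //; apply: IH => //;
  [exact: Ck_onS|exact: Dq|exact: Ck_onS|exact: Dp].
Qed.

Lemma Ck_onZl (W : normedModType R) k U p (w : W) : open U -> Ck_on k U p ->
  Ck_on k U (fun x => p x *: w).
Proof.
move=> Uo; elim: k p => [|k IH] p /=.
  by move=> pc x Ux; apply: continuousZr_tmp; exact: pc.
move=> [dp Dp]; split=> [x Ux|v]; first by apply: differentiableZl; exact: dp.
apply: eq_Ck_on (IH _ (Dp v)) => // x Ux; symmetry.
rewrite !deriveE ?diffZl //; by [exact: dp | apply: differentiableZl; exact: dp].
Qed.

(** The derivative of s^(-1/2) is -1/2 (s^(-1/2))^3. *)
Lemma differentiable_rsqrt p (x : V) : differentiable p x -> 0 < p x ->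
  differentiable (fun y => (Num.sqrt (p y))^-1) x /\
  forall v, 'D_v (fun y => (Num.sqrt (p y))^-1) x =
    (- 2^-1) * (Num.sqrt (p x))^-1 ^+ 3 * 'D_v p x.
Proof.
move=> dp px.
have sx0 : Num.sqrt (p x) != 0 by rewrite gt_eqF // sqrtr_gt0.
have [ds sE] := is_derive1_sqrt px.
have dsq : differentiable (@Num.sqrt R) (p x) by exact/derivable1_diffP.
have dc : differentiable (@Num.sqrt R \o p) x by exact: differentiable_comp.
have dv : differentiable (fun y => (Num.sqrt (p y))^-1) x.
  exact: (@differentiableV _ _ (@Num.sqrt R \o p)).
split=> // v; rewrite (@deriveV _ _ (@Num.sqrt R \o p)) //; last exact: diff_derivable.
rewrite deriveE // diff_comp // (deriveE v dp) /=.
have -> : 'd (@Num.sqrt R) (p x) ('d p x v) = 'd p x v * (2 * Num.sqrt (p x))^-1.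
  by rewrite -sE deriveE // -[in LHS](mulr1 ('d p x v)) -[_ * 1]/(_ *: _) linearZ.
by rewrite /GRing.scale /=; field.
Qed.

(** By induction on [k]: the derivative of [p^(-1/2)] is the product of a
derivative of [p] and of the cube of [p^(-1/2)], which is C^k by induction, up to
a constant. *)
Lemma Ck_on_rsqrt k U p : open U -> (forall x, U x -> 0 < p x) -> Ck_on k U p ->
  Ck_on k U (fun x => (Num.sqrt (p x))^-1).
Proof.
move=> Uo p0; elim: k => [|k IH] pC.
  move=> x Ux; apply: continuousV; first by rewrite gt_eqF // sqrtr_gt0 p0.
  by apply: continuous_comp; [exact: pC | exact: sqrt_continuous].
have [dp Dp] := pC; have {}IH := IH (Ck_onS pC).
split=> [x Ux|v]; first by case: (differentiable_rsqrt (dp _ Ux) (p0 _ Ux)).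
pose s x := (Num.sqrt (p x))^-1.
apply: (@eq_Ck_on _ _ _ _ _
  (fun x => (- 2^-1) * (s x * (s x * s x)) * 'D_v p x)) => // [x Ux|].
  by have [_ ->] := differentiable_rsqrt (dp _ Ux) (p0 _ Ux); rewrite !exprS expr0 mulr1.
apply: (Ck_onM Uo _ (Dp v)).
apply: (Ck_onM Uo (@Ck_on_cst _ _ _ _ _ _)).
by apply: Ck_onM => //; apply: Ck_onM.
Qed.

End SmoothScalar.

Section SmoothOn.
Variables (R : realType) (V W : normedModType R) (U : set V).
Hypothesis U_open : open U.
Implicit Types (p q : V -> R) (f g : V -> W).

Lemma smooth_on_cst (w : W) : smooth_on U (cst w).
Proof. by move=> k; exact: Ck_on_cst. Qed.

Lemma smooth_onD f g : smooth_on U f -> smooth_on U g ->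
  smooth_on U (fun x => f x + g x).
Proof. by move=> fS gS k; exact: Ck_onD. Qed.

Lemma smooth_on_sum (I : Type) (s : seq I) (F : I -> V -> W) :
  (forall i, smooth_on U (F i)) -> smooth_on U (fun x => \sum_(i <- s) F i x).
Proof.
move=> FS; elim: s => [|i s IH].
  rewrite (_ : (fun _ => _) = cst 0); first exact: smooth_on_cst.
  by apply/funext => x; rewrite big_nil.
rewrite (_ : (fun _ => _) = fun x => F i x + \sum_(j <- s) F j x).
  exact: smooth_onD.
by apply/funext => x; rewrite big_cons.
Qed.

Lemma smooth_onM p q : smooth_on U p -> smooth_on U q ->
  smooth_on U (fun x => p x * q x).
Proof. by move=> pS qS k; exact: Ck_onM. Qed.

Lemma smooth_onZl p (w : W) : smooth_on U p -> smooth_on U (fun x => p x *: w).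
Proof. by move=> pS k; exact: Ck_onZl. Qed.

Lemma smooth_on_rsqrt p : (forall x, U x -> 0 < p x) -> smooth_on U p ->
  smooth_on U (fun x => (Num.sqrt (p x))^-1).
Proof. by move=> p0 pS k; exact: Ck_on_rsqrt. Qed.

End SmoothOn.

Section SmoothMatrix.
Variables (R : realType) (V W : normedModType R) (U : set V).
Hypothesis U_open : open U.

Lemma smooth_onN (p : V -> R) : smooth_on U p -> smooth_on U (fun x => - p x).
Proof.
move=> pS; under eq_fun do rewrite -mulN1r.
by apply: smooth_onM => //; exact: smooth_on_cst.
Qed.

(** [p^(1/2) = p * p^(-1/2)] where [p > 0]. *)
Lemma smooth_on_sqrt (p : V -> R) : (forall x, U x -> 0 < p x) ->
  smooth_on U p -> smooth_on U (fun x => Num.sqrt (p x)).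
Proof.
move=> p0 pS k; have rS := smooth_onM U_open pS (smooth_on_rsqrt U_open p0 pS).
apply: eq_Ck_on (rS k) => // x Ux.
have sx0 : Num.sqrt (p x) != 0 by rewrite gt_eqF // sqrtr_gt0 p0.
by rewrite -{1}(sqr_sqrtr (ltW (p0 _ Ux))) expr2 mulfK.
Qed.

(** [L (F x)] is the sum of the entries of [F x] times the constant vectors
[L (delta_mx i j)].  Taking [L] into the statement covers at once the maps into
the matrices and the maps into su(2)^3. *)
Lemma smooth_on_linear_mx m n (L : 'M[R]_(m, n) -> W) (F : V -> 'M[R]_(m, n)) :
  linear L -> (forall i j, smooth_on U (fun x => F x i j)) ->
  smooth_on U (fun x => L (F x)).
Proof.
move=> L_lin FS; pose LL : {linear 'M[R]_(m, n) -> W} :=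
  HB.pack L (GRing.isLinear.Build _ _ _ _ _ L_lin).
rewrite (_ : (fun x => _) = fun x => \sum_i \sum_j F x i j *: LL (delta_mx i j)).
  by do 2![apply: smooth_on_sum => // ?]; exact: smooth_onZl.
apply/funext => x; rewrite -[L _]/(LL _) [F x in LHS]matrix_sum_delta linear_sum.
by apply: eq_bigr => i _; rewrite linear_sum; apply: eq_bigr => j _; rewrite linearZ.
Qed.

End SmoothMatrix.

(** * Matrices of size 3 *)

Local Notation i0 := (@Ordinal 3 0 isT).
Local Notation i1 := (@Ordinal 3 1 isT).
Local Notation i2 := (@Ordinal 3 2 isT).

Lemma ord3P (P : 'I_3 -> Prop) : P i0 -> P i1 -> P i2 -> forall i, P i.
Proof.
by move=> P0 P1 P2 [[|[|[|//]]] lt_i3];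
  [move: P0|move: P1|move: P2]; congr P; exact: val_inj.
Qed.

Lemma sum3E (R : nmodType) (F : 'I_3 -> R) : \sum_i F i = F i0 + F i1 + F i2.
Proof.
rewrite !big_ord_recl big_ord0 addr0 addrA.
by congr (F _ + F _ + F _); exact: val_inj.
Qed.

Lemma det_mx22 (R : comNzRingType) (M : 'M[R]_2) :
  \det M = M ord0 ord0 * M ord_max ord_max - M ord0 ord_max * M ord_max ord0.
Proof.
rewrite (expand_det_row _ ord0) !big_ord_recl big_ord0 addr0 /cofactor !det_mx11.
rewrite !mxE /= expr0 expr1 mul1r mulN1r mulrN.
by congr (_ * M _ _ - M _ _ * M _ _); exact: val_inj.
Qed.

Lemma det_mx33 (R : comNzRingType) (M : 'M[R]_3) :
  \det M = M i0 i0 * (M i1 i1 * M i2 i2 - M i1 i2 * M i2 i1)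
         + M i0 i1 * (M i1 i2 * M i2 i0 - M i1 i0 * M i2 i2)
         + M i0 i2 * (M i1 i0 * M i2 i1 - M i1 i1 * M i2 i0).
Proof.
rewrite (expand_det_row _ i0) sum3E /cofactor !det_mx22 !mxE /=.
have E (i j : 'I_3) : (i = j :> nat) -> i = j by exact: val_inj.
have L01 : lift i0 (ord0 : 'I_2) = i1 by exact: E.
have L02 : lift i0 (ord_max : 'I_2) = i2 by exact: E.
have L10 : lift i1 (ord0 : 'I_2) = i0 by exact: E.
have L12 : lift i1 (ord_max : 'I_2) = i2 by exact: E.
have L20 : lift i2 (ord0 : 'I_2) = i0 by exact: E.
have L21 : lift i2 (ord_max : 'I_2) = i1 by exact: E.
rewrite L01 L02 L10 L12 L20 L21.
rewrite /= !expr2 expr1 expr0; ring.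
Qed.

(** * Orthonormal coordinates on su(2) *)

Lemma nonexpansive_linear_continuous (R : realType) (V W : normedModType R) (f : V -> W) :
  linear f -> (forall x, `|f x| <= `|x|) -> continuous f.
Proof.
move=> f_lin f_le x; apply/cvgrPdist_le => e e0.
have : \forall y \near x, `|x - y| <= e.
  by apply: (@cvgr_dist_le _ _ _ (nbhs x) _ id) => //; exact: cvg_id.
apply: filterS => y; apply: le_trans; apply: le_trans (f_le _).
by have := f_lin (-1) y x; rewrite !scaleN1r [X in f X]addrC [X in _ = X]addrC => <-.
Qed.

Section Su2Coordinates.
Local Open Scope complex_scope.
Variable R : realType.
Implicit Types (x y : su2 R) (v : 'I_3 -> R).

(** The factor 2 makes these coordinates orthonormal, as the inner product is 4
times the dot product in the entries. *)
Definition su2_coord (j : 'I_3) x : R :=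
  2 * tnth [tuple su2_ca x; su2_cb x; su2_cc x] j.

Definition su2_mx v : 'M[R[i]]_2 :=
  \matrix_(i < 2, j < 2)
    if i == 0 then if j == 0 then 0 +i* (v i0 / 2) else (v i1 / 2) +i* (v i2 / 2)
    else if j == 0 then (- (v i1 / 2)) +i* (v i2 / 2) else 0 +i* - (v i0 / 2).

Lemma su2_of_subproof v : su2_mx v \in su2_pred R.
Proof.
rewrite !inE; apply/andP; split.
  apply/eqP/matrixP => -[[|[|//]] hi] [[|[|//]] hj]; rewrite !mxE /=;
  by apply/eqP; rewrite eq_complex /=; apply/andP; split; apply/eqP; ring.
rewrite /mxtrace !big_ord_recl big_ord0 !mxE /=.
by apply/eqP/eqP; rewrite eq_complex /=; apply/andP; split; apply/eqP; ring.
Qed.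

Definition su2_of v : su2 R := Su2 (su2_of_subproof v).

Lemma su2_ofK v j : su2_coord j (su2_of v) = v j.
Proof.
by elim/ord3P: j; rewrite /su2_coord (tnth_nth 0) /=
  /su2_ca /su2_cb /su2_cc /= !mxE /=; field.
Qed.

Lemma su2_coordK x : su2_of (su2_coord^~ x) = x.
Proof.
apply: val_inj; apply/matrixP => i j; rewrite !mxE.
have [E00 E01 E10 E11] := su2_entries x.
rewrite /su2_coord !(tnth_nth 0) /= ![2 * _]mulrC !mulfK ?pnatr_eq0 //.
have or2 (k : 'I_2) : k = 0 \/ k = 1.
  by case: k => [[|[|//]] k2]; [left|right]; exact: val_inj.
by case: (or2 i) => ->; case: (or2 j) => -> /=; rewrite ?E00 ?E01 ?E10 ?E11.
Qed.

Lemma su2_inner_sum x y :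
  su2_inner x y = \sum_j su2_coord j x * su2_coord j y.
Proof. by rewrite su2_inner_coord sum3E /su2_coord !(tnth_nth 0) /=; ring. Qed.

(** With the same factor 2, the bracket is the cross product on the nose; this
fixes the orientation, and so the sign of the triple product. *)
Lemma su2_coord_bracket x y :
  [/\ su2_coord i0 (su2_bracket x y) =
         su2_coord i1 x * su2_coord i2 y - su2_coord i2 x * su2_coord i1 y,
       su2_coord i1 (su2_bracket x y) =
         su2_coord i2 x * su2_coord i0 y - su2_coord i0 x * su2_coord i2 y
     & su2_coord i2 (su2_bracket x y) =
         su2_coord i0 x * su2_coord i1 y - su2_coord i1 x * su2_coord i0 y].
Proof.
have [X00 X01 X10 X11] := su2_entries x; have [Y00 Y01 Y10 Y11] := su2_entries y.
have o1 : lift ord0 (ord0 : 'I_1) = 1 :> 'I_2 by apply: val_inj.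
have ca : su2_ca (su2_bracket x y) =
    2 * (su2_cb x * su2_cc y - su2_cc x * su2_cb y).
  rewrite {1}/su2_ca /= !mxE !big_ord_recl !big_ord0 !addr0 o1.
  by rewrite X00 X01 X10 Y00 Y01 Y10 /=; ring.
have cb : su2_cb (su2_bracket x y) =
    2 * (su2_cc x * su2_ca y - su2_ca x * su2_cc y).
  rewrite {1}/su2_cb /= !mxE !big_ord_recl !big_ord0 !addr0 o1.
  by rewrite X00 X01 X11 Y00 Y01 Y11 /=; ring.
have cc : su2_cc (su2_bracket x y) =
    2 * (su2_ca x * su2_cb y - su2_cb x * su2_ca y).
  rewrite {1}/su2_cc /= !mxE !big_ord_recl !big_ord0 !addr0 o1.
  by rewrite X00 X01 X11 Y00 Y01 Y11 /=; ring.
by rewrite /su2_coord !(tnth_nth 0) /= ca cb cc; split; ring.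
Qed.

Lemma su2_coord_linear j : linear (su2_coord j : su2 R -> R).
Proof.
move=> a x y; elim/ord3P: j; rewrite /su2_coord !(tnth_nth 0) /=
  /su2_ca /su2_cb /su2_cc /= !mxE;
  case: (su2_val x 0 0) => ? ?; case: (su2_val x 0 1) => ? ?;
  case: (su2_val y 0 0) => ? ?; case: (su2_val y 0 1) => ? ?;
  rewrite /= /GRing.scale /=; ring.
Qed.

(** The norm is the Euclidean norm of the coordinates, which dominates each of
them. *)
Lemma su2_coord_continuous j : continuous (su2_coord j).
Proof.
apply: nonexpansive_linear_continuous; first exact: su2_coord_linear.
move=> z; rewrite -[`|z|]/(su2_norm z) -sqrtr_sqr
  ler_wsqrtr // su2_inner_sum (bigD1 j) //=.
by rewrite -expr2 lerDl sumr_ge0 // => k _; rewrite -expr2 sqr_ge0.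
Qed.

End Su2Coordinates.

(** * Triples in su(2) as matrices *)

Section Frame.
Variable R : realType.
Implicit Types (a : su2 R * su2 R * su2 R) (M Q : 'M[R]_3).

Definition frame a : 'M[R]_3 :=
  \matrix_(i, j) su2_coord j (tnth [tuple a.1.1; a.1.2; a.2] i).

Definition unframe M : su2 R * su2 R * su2 R :=
  (su2_of (M i0), su2_of (M i1), su2_of (M i2)).

Lemma frameK : cancel frame unframe.
Proof.
move=> a; have rowE i : su2_of (frame a i) = tnth [tuple a.1.1; a.1.2; a.2] i.
  by rewrite -[RHS]su2_coordK; congr su2_of; apply/funext => j; rewrite mxE.
by rewrite /unframe !rowE !(tnth_nth 0) /=; case: a {rowE} => [[]].
Qed.

Lemma unframeK : cancel unframe frame.
Proof.
move=> M; apply/matrixP => i j; rewrite mxE.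
by elim/ord3P: i; rewrite (tnth_nth 0) /= su2_ofK.
Qed.

Lemma frame_gram a i k : (frame a *m (frame a)^T) i k =
  su2_inner (tnth [tuple a.1.1; a.1.2; a.2] i) (tnth [tuple a.1.1; a.1.2; a.2] k).
Proof. by rewrite su2_inner_sum mxE; apply: eq_bigr => j _; rewrite !mxE. Qed.

Lemma det_frame a : \det (frame a) = su2_inner a.1.1 (su2_bracket a.1.2 a.2).
Proof.
rewrite det_mx33 su2_inner_sum sum3E.
have [-> -> ->] := su2_coord_bracket a.1.2 a.2.
by rewrite !mxE !(tnth_nth 0) /=; ring.
Qed.

Definition sq_lengths (q r t : R) : 'rV[R]_3 := \row_i tnth [tuple t + r + q; t + r; t] i.

(** The Gram matrix carries the orthogonality relations off the diagonal and the
differences [q], [r] of the squared lengths on it. *)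
Lemma Nqr_frame q r a : Nqr q r a <->
  \det (frame a) < 0 /\
  frame a *m (frame a)^T = diag_mx (sq_lengths q r (su2_inner a.2 a.2)).
Proof.
rewrite det_frame; split.
  case: a => [[a1 a2] a3] [/= det_lt0 orth a12 a23]; split=> //.
  apply/matrixP => i k; rewrite frame_gram !mxE.
  have [<-|ik] := eqVneq i k; last by rewrite orth.
  rewrite mulr1n; elim/ord3P: i; rewrite !(tnth_nth 0) /=; lra.
case: a => [[a1 a2] a3] [/= det_lt0 /matrixP gramE]; split=> //.
- move=> i k ik; have := gramE i k.
  by rewrite frame_gram !mxE (negbTE ik).
- have := gramE i0 i0; have := gramE i1 i1.
  by rewrite !frame_gram !mxE !(tnth_nth 0) /=; lra.
have := gramE i1 i1; rewrite !frame_gram !mxE !(tnth_nth 0) /=; lra.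
Qed.

Lemma frame_coord_linear i j : linear (fun a => frame a i j : R).
Proof.
by move=> c a b; rewrite !mxE; elim/ord3P: i; rewrite !(tnth_nth 0) /= su2_coord_linear.
Qed.

Lemma frame_coord_continuous i j : continuous (fun a => frame a i j).
Proof.
move=> a; rewrite (_ : (fun a => _) =
   su2_coord j \o (fun a => tnth [tuple a.1.1; a.1.2; a.2] i)); last first.
  by apply/funext => b; rewrite mxE.
apply: continuous_comp; last exact: su2_coord_continuous.
elim/ord3P: i.
- apply: (@continuous_comp _ _ _ fst fst); exact: cvg_fst.
- apply: (@continuous_comp _ _ _ fst snd); [exact: cvg_fst|exact: cvg_snd].
- exact: cvg_snd.
Qed.

Lemma unframe_linear : linear unframe.
Proof.
move=> c M N; apply: (can_inj frameK); rewrite unframeK.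
by apply/matrixP => i j; rewrite frame_coord_linear !unframeK !mxE.
Qed.

Lemma frame_smooth U i j : smooth_on U (fun a => frame a i j).
Proof.
apply: smooth_on_linear; [exact: frame_coord_linear|exact: frame_coord_continuous].
Qed.

End Frame.

(** * The diffeomorphism *)

Section Polar.
Variable R : realType.
Implicit Types (a : su2 R * su2 R * su2 R) (M Q : 'M[R]_3) (d : 'rV[R]_3).

(** The minus signs turn a frame of negative determinant into a rotation, the
dimension being odd. *)
Definition neg_lengths d : 'rV[R]_3 := \row_i - Num.sqrt (d 0 i).
Definition inv_neg_lengths d : 'rV[R]_3 := \row_i - (Num.sqrt (d 0 i))^-1.

Lemma mul_neg_lengthsE d M i j :
  (diag_mx (neg_lengths d) *m M) i j = - Num.sqrt (d 0 i) * M i j.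
Proof. by rewrite mul_diag_mx !mxE. Qed.

Lemma mul_inv_neg_lengthsE d M i j :
  (diag_mx (inv_neg_lengths d) *m M) i j = - (Num.sqrt (d 0 i))^-1 * M i j.
Proof. by rewrite mul_diag_mx !mxE. Qed.

Lemma neg_lengthsK d M : (forall i, 0 < d 0 i) ->
  diag_mx (inv_neg_lengths d) *m (diag_mx (neg_lengths d) *m M) = M.
Proof.
move=> d0; apply/matrixP => i j; rewrite !mul_diag_mx !mxE mulrA mulrNN.
by rewrite mulVf ?mul1r // gt_eqF // sqrtr_gt0.
Qed.

Lemma inv_neg_lengthsK d M : (forall i, 0 < d 0 i) ->
  diag_mx (neg_lengths d) *m (diag_mx (inv_neg_lengths d) *m M) = M.
Proof.
move=> d0; apply/matrixP => i j; rewrite !mul_diag_mx !mxE mulrA mulrNN.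
by rewrite divff ?mul1r // gt_eqF // sqrtr_gt0.
Qed.

Lemma det_diag_neg (s : 'rV[R]_3) : (forall i, s 0 i < 0) -> \det (diag_mx s) < 0.
Proof.
move=> s0; rewrite det_diag !big_ord_recl big_ord0 mulr1.
by rewrite nmulr_rlt0 // nmulr_lgt0.
Qed.

Lemma gram_diag_mul (s : 'rV[R]_3) M :
  (diag_mx s *m M) *m (diag_mx s *m M)^T = diag_mx s *m (M *m M^T) *m diag_mx s.
Proof. by rewrite trmx_mul tr_diag_mx !mulmxA. Qed.

(** [Q Q^T] is [diag (d^(-1/2)) * diag d * diag (d^(-1/2)) = 1]; hence [det Q] is 1
or -1, and it is positive as a product of two negative determinants. *)
Lemma SO3_normalize d M : (forall i, 0 < d 0 i) ->
  \det M < 0 -> M *m M^T = diag_mx d -> SO3 R (diag_mx (inv_neg_lengths d) *m M).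
Proof.
move=> d0 detM gramM; set Q := _ *m M.
have QQ : Q *m Q^T = 1%:M.
  rewrite gram_diag_mul gramM; apply/matrixP => i j; rewrite mul_mx_diag mul_diag_mx !mxE.
  have [->|_] := eqVneq i j; last by rewrite mulr0n mulr0 mul0r.
  have s0 : Num.sqrt (d 0 j) != 0 by rewrite gt_eqF // sqrtr_gt0.
  by rewrite !mulr1n -{2}(sqr_sqrtr (ltW (d0 j))); field.
split=> //; have detQ0 : 0 < \det Q.
  rewrite det_mulmx nmulr_lgt0 //; apply: det_diag_neg => i.
  by rewrite mxE oppr_lt0 invr_gt0 sqrtr_gt0.
have /eqP := congr1 determinant QQ; rewrite det_mulmx det_tr det1 -expr2.
by rewrite sqrf_eq1 => /orP[/eqP //|/eqP detQ]; move: detQ0; rewrite detQ oppr_gt0 ltr10.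
Qed.

Lemma SO3_stretch d Q : (forall i, 0 < d 0 i) -> SO3 R Q ->
  let M := diag_mx (neg_lengths d) *m Q in \det M < 0 /\ M *m M^T = diag_mx d.
Proof.
move=> d0 [QQ detQ] M; split.
  by rewrite det_mulmx detQ mulr1; apply: det_diag_neg => i;
    rewrite mxE oppr_lt0 sqrtr_gt0.
rewrite gram_diag_mul QQ mulmx1; apply/matrixP => i j; rewrite mul_diag_mx !mxE.
have [->|_] := eqVneq i j; last by rewrite !mulr0n mulr0.
by rewrite !mulr1n mulrNN -expr2 sqr_sqrtr // ltW.
Qed.

Variables q r : R.
Hypotheses (q_ge0 : 0 <= q) (r_ge0 : 0 <= r).

Lemma sq_lengths_gt0 (t : R) i : 0 < t -> 0 < sq_lengths q r t 0 i.
Proof. by move=> t0; rewrite mxE; elim/ord3P: i; rewrite (tnth_nth 0) /= ?ltr_wpDr. Qed.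

Definition to_polar a : R * 'M[R]_3 :=
  let t := su2_inner a.2 a.2 in (t, diag_mx (inv_neg_lengths (sq_lengths q r t)) *m frame a).

Definition of_polar (p : R * 'M[R]_3) : su2 R * su2 R * su2 R :=
  unframe (diag_mx (neg_lengths (sq_lengths q r p.1)) *m p.2).

(** If [a.2] were 0, the Gram determinant, hence the triple product, would
vanish. *)
Lemma Nqr_radius_gt0 a : Nqr q r a -> 0 < su2_inner a.2 a.2.
Proof.
move=> Na; have [det_lt0 gramE] := (Nqr_frame q r a).1 Na.
rewrite lt_neqAle su2_inner_ge0 andbT eq_sym.
apply: contraTneq (det_lt0) => t0.
have /eqP := congr1 determinant gramE.
rewrite det_mulmx det_tr det_diag (bigD1 i2) //= mxE (tnth_nth 0) /= t0 mul0r.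
by rewrite mulf_eq0 orbb => /eqP ->; rewrite ltxx.
Qed.

Lemma to_polarP a : Nqr q r a -> ([set t : R | 0 < t] `*` SO3 R) (to_polar a).
Proof.
move=> Na; have t0 := Nqr_radius_gt0 Na; split=> //=.
have [det_lt0 gramE] := (Nqr_frame q r a).1 Na.
by apply: SO3_normalize => // i; exact: sq_lengths_gt0.
Qed.

Lemma of_polar_inner p : 0 < p.1 -> SO3 R p.2 ->
  su2_inner (of_polar p).2 (of_polar p).2 = p.1.
Proof.
move=> t0 SQ; have := @SO3_stretch (sq_lengths q r p.1) p.2.
case=> [i||_ /matrixP/(_ i2 i2)]; [exact: sq_lengths_gt0|by []|].
rewrite -[diag_mx _ *m p.2]unframeK frame_gram !(tnth_nth 0) /= => ->.
by rewrite !mxE (tnth_nth 0) mulr1n.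
Qed.

Lemma of_polarP p : ([set t : R | 0 < t] `*` SO3 R) p -> Nqr q r (of_polar p).
Proof.
move=> [t0 SQ]; apply: (Nqr_frame q r _).2; rewrite of_polar_inner // unframeK.
by apply: SO3_stretch => // i; exact: sq_lengths_gt0.
Qed.

Lemma to_polarK a : Nqr q r a -> of_polar (to_polar a) = a.
Proof.
move=> Na; rewrite /of_polar /to_polar /= inv_neg_lengthsK ?frameK // => i.
exact/sq_lengths_gt0/Nqr_radius_gt0.
Qed.

Lemma of_polarK p : ([set t : R | 0 < t] `*` SO3 R) p -> to_polar (of_polar p) = p.
Proof.
move=> [/= t0 SQ]; rewrite /to_polar of_polar_inner // unframeK
  neg_lengthsK -?surjective_pairing //.
by move=> i; exact: sq_lengths_gt0.
Qed.

Lemma to_polar_bij : set_bij (Nqr q r) ([set t : R | 0 < t] `*` SO3 R) to_polar.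
Proof.
split; first exact: to_polarP.
  by apply: (can_in_inj (g := of_polar)) => a /set_mem; exact: to_polarK.
by move=> p pP; exists (of_polar p); [exact: of_polarP|exact: of_polarK].
Qed.

Lemma sq_lengths_smooth (V : normedModType R) (U : set V) (t : V -> R) i :
  open U -> smooth_on U t -> smooth_on U (fun x => sq_lengths q r (t x) 0 i).
Proof.
move=> Uo tS; have addc (c : R) (u : V -> R) :
    smooth_on U u -> smooth_on U (fun x => u x + c).
  by move=> uS; apply: smooth_onD => //; exact: smooth_on_cst.
under eq_fun do rewrite mxE.
by elim/ord3P: i; under eq_fun do rewrite (tnth_nth 0) /=;
  [exact: (addc _ _ (addc _ _ tS))|exact: (addc _ _ tS)|exact: tS].
Qed.

(** The formula of [to_polar] itself is smooth on the open set where [a.2] is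
nonzero. *)
Lemma to_polar_smooth : smooth_map (Nqr q r) to_polar.
Proof.
move=> a Na; pose t (b : su2 R * su2 R * su2 R) : R := su2_inner b.2 b.2.
have tE : t = fun b => \sum_j frame b i2 j * frame b i2 j.
  by apply/funext => b; rewrite /t su2_inner_sum; apply: eq_bigr => j _; rewrite !mxE.
have tS U : open U -> smooth_on U t.
  move=> Uo; rewrite tE; apply: smooth_on_sum => // j.
  by apply: smooth_onM => //; exact: frame_smooth.
exists (t @^-1` [set s | 0 < s]), to_polar; split=> //.
- apply: open_comp; last exact: open_gt.
  by move=> b _; have /(_ 0%N b I) := tS _ openT.
- exact: Nqr_radius_gt0.
set U := (X in smooth_on X _).
have Uo : open U.
  apply: open_comp; last exact: open_gt.
  by move=> b _; have /(_ 0%N b I) := tS _ openT.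
rewrite (_ : to_polar = fun b => t b *: ((1, 0) : R * 'M[R]_3) +
    (0, diag_mx (inv_neg_lengths (sq_lengths q r (t b))) *m frame b)); last first.
  apply/funext => b; congr pair; first by rewrite /= /GRing.scale /= mulr1 addr0.
  by rewrite /= scaler0 add0r.
apply: smooth_onD => //; first by apply: smooth_onZl => //; exact: tS.
apply: (@smooth_on_linear_mx _ _ _ _ Uo _ _ (fun Q => (0, Q) : R * 'M[R]_3)).
  by move=> c P Q; congr pair; rewrite /= scaler0 addr0.
move=> i j; under eq_fun do rewrite mul_inv_neg_lengthsE.
apply: smooth_onM => //; last exact: frame_smooth.
apply: smooth_onN => //; apply: smooth_on_rsqrt => //.
  by move=> b Ub; exact: sq_lengths_gt0.
by apply: sq_lengths_smooth => //; exact: tS.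
Qed.

Lemma of_polar_smooth : smooth_map ([set t : R | 0 < t] `*` SO3 R) of_polar.
Proof.
move=> p [/= p0 _].
exists (fst @^-1` [set s : R | 0 < s]), of_polar; split=> //.
- apply: open_comp; last exact: open_gt.
  by move=> b _; exact: cvg_fst.
set U := (X in smooth_on X _).
have Uo : open U.
  by apply: open_comp; [move=> b _; exact: cvg_fst|exact: open_gt].
apply: smooth_on_linear_mx => //; first exact: unframe_linear.
move=> i j; under eq_fun do rewrite mul_neg_lengthsE.
apply: smooth_onM => //; last first.
  apply: smooth_on_linear => [c x y|x]; first by rewrite /= !mxE.
  by apply: (@continuous_comp _ _ _ snd (fun M : 'M[R]_3 => M i j));
    [exact: cvg_snd|exact: coord_continuous].
apply: smooth_onN => //; apply: smooth_on_sqrt => //.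
  by move=> b Ub; exact: sq_lengths_gt0.
apply: sq_lengths_smooth => //; apply: smooth_on_linear => [c x y //|x]; exact: cvg_fst.
Qed.

End Polar.

(** * Connectedness *)

Lemma smooth_map_within_continuous (R : realType) (V W : normedModType R)
    (A : set V) (f : V -> W) : smooth_map A f -> {within A, continuous f}.
Proof.
move=> fS; apply/subspace_continuousP => x Ax.
have [U [F [Uo Ux /(_ 0%N) FC FE]]] := fS _ Ax.
have : F @ within A (nbhs x) --> F x by apply: cvg_within_filter; exact: FC.
rewrite FE // => Fx.
apply: cvg_trans Fx; apply: near_eq_cvg; rewrite near_withinE.
near=> y => Ay; apply: FE => //.
by near: y; exact: open_nbhs_nbhs.
Unshelve. all: by end_near. Qed.

(** The paths are defined on the whole line, so that [A] is a union of images of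
the connected set [R], all of which contain [x0]. *)
Lemma path_connected_connected (R : realType) (T : topologicalType) (A : set T)
    (x0 : T) : A x0 ->
  (forall x, A x -> exists c : R -> T,
    [/\ continuous c, forall s, A (c s), c 0 = x0 & c 1 = x]) ->
  connected A.
Proof.
move=> Ax0 pathA.
pose C := [set c : R -> T | [/\ continuous c, forall s, A (c s) & c 0 = x0]].
have -> : A = \bigcup_(c in C) range c.
  apply/seteqP; split=> [x Ax|_ [c [_ cA _] [s _ <-]]]; last exact: cA.
  by have [c [cc cA c0 c1]] := pathA _ Ax; exists c => //; exists 1.
apply: bigcup_connected => [|c [cc _ _]].
  by exists x0 => c [_ _ <-]; exists 0.
apply: connected_continuous_connected; last exact: continuous_subspaceT.
exact/connected_intervalP.
Qed.

Lemma continuous_mx (R : realType) (T : topologicalType) m n (F : T -> 'M[R]_(m, n)) :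
  (forall i j, continuous (fun x => F x i j)) -> continuous F.
Proof.
move=> Fc x; apply/cvg_ballP => e e0.
have : \forall y \near x, forall ij : 'I_m * 'I_n, ball (F x ij.1 ij.2) e (F y ij.1 ij.2).
  by apply: filter_forall => -[i j]; move/cvg_ballP: (Fc i j x); exact.
by apply: filterS => y Fy; split=> // i j; exact: (Fy (i, j)).
Qed.

Section Rotations.
Variable R : realType.
Implicit Types (Q : 'M[R]_3) (t : R).

(** The arc cosine of [u] has the sine [|v|]; its opposite serves when [v < 0]. *)
Lemma circle_angle (u v : R) : u ^+ 2 + v ^+ 2 = 1 ->
  exists t, cos t = u /\ sin t = v.
Proof.
move=> uv1; have u1 : -1 <= u <= 1 by apply/andP; split; nra.
have cu : cos (acos u) = u by rewrite acosK // in_itv.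
have su : sin (acos u) = `|v|.
  by rewrite sin_acos // -uv1 addrC addKr sqrtr_sqr.
have [v0|v0] := leP 0 v; first by exists (acos u); rewrite su ger0_norm.
by exists (- acos u); rewrite cosN sinN su ltr0_norm // opprK.
Qed.

(** [t] is the angle from [(u, v)] to the second axis; at the origin, every angle
serves. *)
Lemma givens_angle (u v : R) :
  exists t, cos t * u + sin t * v = 0 /\ 0 <= - sin t * u + cos t * v.
Proof.
pose l := Num.sqrt (u ^+ 2 + v ^+ 2).
have uv0 : 0 <= u ^+ 2 + v ^+ 2 by rewrite addr_ge0 ?sqr_ge0.
have l2 : l ^+ 2 = u ^+ 2 + v ^+ 2 by rewrite sqr_sqrtr.
have l0 : 0 <= l by rewrite sqrtr_ge0.
have [lz|lnz] := eqVneq l 0.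
  have [u0 v0] : u = 0 /\ v = 0 by split; nra.
  by exists 0; rewrite u0 v0 !mulr0 addr0.
have [|t [ct st]] := @circle_angle (v / l) (- (u / l)).
  by rewrite sqrrN !expr_div_n -mulrDl addrC -l2 divff // expf_neq0.
exists t; rewrite ct st; split; first by field.
rewrite opprK (_ : _ + _ = l) //.
by apply: (mulIf lnz); rewrite -expr2 l2; field.
Qed.

(** The sign of the sines is chosen so that left multiplication by [rotz t] acts
on the first two entries of a column as in [givens_angle]; likewise for
[rotx t] and the last two. *)
Definition rotz t : 'M[R]_3 := \matrix_(i, j)
  nth 0 (nth [::] [:: [:: cos t; sin t; 0]; [:: - sin t; cos t; 0]; [:: 0; 0; 1]] i) j.

Definition rotx t : 'M[R]_3 := \matrix_(i, j)
  nth 0 (nth [::] [:: [:: 1; 0; 0]; [:: 0; cos t; sin t]; [:: 0; - sin t; cos t]] i) j.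

Lemma SO3_rotz t : SO3 R (rotz t).
Proof.
have cs := cos2Dsin2 t; split; last by rewrite det_mx33 !mxE /=; lra.
apply/matrixP => i j; rewrite mxE sum3E !mxE.
by elim/ord3P: i; elim/ord3P: j; rewrite /=; lra.
Qed.

Lemma SO3_rotx t : SO3 R (rotx t).
Proof.
have cs := cos2Dsin2 t; split; last by rewrite det_mx33 !mxE /=; lra.
apply/matrixP => i j; rewrite mxE sum3E !mxE.
by elim/ord3P: i; elim/ord3P: j; rewrite /=; lra.
Qed.

Lemma SO3_mul P Q : SO3 R P -> SO3 R Q -> SO3 R (P *m Q).
Proof.
move=> [PP dP] [QQ dQ]; split; last by rewrite det_mulmx dP dQ mulr1.
by rewrite trmx_mul mulmxA -(mulmxA P) QQ mulmx1.
Qed.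

(** The last column has norm 1 and a single nonzero entry, so it is the last
basis vector, and so is the last row.  The remaining 2 x 2 block has orthonormal
rows and determinant 1. *)
Lemma SO3_fix_axis Q : SO3 R Q -> Q i0 i2 = 0 -> Q i1 i2 = 0 -> 0 <= Q i2 i2 ->
  exists t, Q = rotz t.
Proof.
move=> [QQ dQ] Q02 Q12 Q22.
have QtQ : Q^T *m Q = 1%:M by exact: mulmx1C.
have e i j := congr1 (fun M : 'M[R]_3 => M i j) QQ.
have e' i j := congr1 (fun M : 'M[R]_3 => M i j) QtQ.
have := e' i2 i2; have := e i2 i2; have := e i0 i0; have := e i1 i1.
rewrite !mxE !sum3E !mxE /= mulr1n Q02 Q12 => h11 h00 h22 k22.
have Q22E : Q i2 i2 = 1 by nra.
have Q20 : Q i2 i0 = 0 by rewrite Q22E in h22; nra.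
have Q21 : Q i2 i1 = 0 by rewrite Q22E in h22; nra.
move: dQ; rewrite det_mx33 Q02 Q12 Q22E Q20 Q21 => dQ.
(* The left side is the sum of the squared norms of two unit rows, minus
   twice the determinant. *)
have sq0 : (Q i0 i0 - Q i1 i1) ^+ 2 + (Q i0 i1 + Q i1 i0) ^+ 2 = 0 by nra.
have /eqP := sq0; rewrite paddr_eq0 ?sqr_ge0 // !sqrf_eq0 subr_eq0 addr_eq0.
move=> /andP[/eqP Q00 /eqP Q01].
have [|t [ct st]] := @circle_angle (Q i0 i0) (Q i0 i1); first by rewrite !expr2; lra.
exists t; apply/matrixP => i j; rewrite mxE.
by elim/ord3P: i; elim/ord3P: j; rewrite /= ?ct ?st // Q01 opprK.
Qed.

Lemma rotzN t : rotz (- t) *m rotz t = 1%:M.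
Proof.
have cs := cos2Dsin2 t; apply/matrixP => i j; rewrite mxE sum3E !mxE cosN sinN.
by elim/ord3P: i; elim/ord3P: j; rewrite /=; lra.
Qed.

Lemma rotxN t : rotx (- t) *m rotx t = 1%:M.
Proof.
have cs := cos2Dsin2 t; apply/matrixP => i j; rewrite mxE sum3E !mxE cosN sinN.
by elim/ord3P: i; elim/ord3P: j; rewrite /=; lra.
Qed.

(** Euler angles: one rotation clears the first entry of the last column, a second
one the middle entry, and what is left fixes the last axis. *)
Lemma SO3_euler Q : SO3 R Q ->
  exists a b c, Q = rotz a *m (rotx b *m rotz c).
Proof.
move=> SQ; have [t [t0 t1]] := givens_angle (Q i0 i2) (Q i1 i2).
pose P := rotz t *m Q.
have [s [s0 s1]] := givens_angle (P i1 i2) (P i2 i2).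
have [||||c cE] := @SO3_fix_axis (rotx s *m P).
- by apply: SO3_mul (SO3_rotx s) _; exact: SO3_mul (SO3_rotz t) SQ.
- rewrite mxE sum3E ![rotx s _ _]mxE /= !mul0r !addr0 mul1r.
  by rewrite mxE sum3E ![rotz t _ _]mxE /=; lra.
- by rewrite mxE sum3E ![rotx s _ _]mxE /=; lra.
- by rewrite mxE sum3E ![rotx s _ _]mxE /=; lra.
exists (- t), (- s), c; rewrite -cE (mulmxA _ (rotx s)) rotxN mul1mx /P.
by rewrite mulmxA rotzN mul1mx.
Qed.

Lemma rotz0 : rotz 0 = 1%:M.
Proof.
apply/matrixP => i j; rewrite !mxE cos0 sin0.
by elim/ord3P: i; elim/ord3P: j; rewrite /= ?oppr0.
Qed.

Lemma rotx0 : rotx 0 = 1%:M.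
Proof.
apply/matrixP => i j; rewrite !mxE cos0 sin0.
by elim/ord3P: i; elim/ord3P: j; rewrite /= ?oppr0.
Qed.

Lemma rotz_continuous i j : continuous (fun t => rotz t i j).
Proof.
under eq_fun do rewrite mxE.
by elim/ord3P: i; elim/ord3P: j => /= t; do ?[exact: cst_continuous | apply: continuousN];
  [exact: continuous_cos | exact: continuous_sin | exact: continuous_sin | exact: continuous_cos].
Qed.

Lemma rotx_continuous i j : continuous (fun t => rotx t i j).
Proof.
under eq_fun do rewrite mxE.
by elim/ord3P: i; elim/ord3P: j => /= t; do ?[exact: cst_continuous | apply: continuousN];
  [exact: continuous_cos | exact: continuous_sin | exact: continuous_sin | exact: continuous_cos].
Qed.

Lemma continuous_mulmx3 (T : topologicalType) (F G : T -> 'M[R]_3) :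
  (forall i j, continuous (fun x => F x i j)) ->
  (forall i j, continuous (fun x => G x i j)) ->
  forall i j, continuous (fun x => (F x *m G x) i j).
Proof.
move=> Fc Gc i j; under eq_fun do rewrite mxE sum3E.
move=> x; have FG k : {for x, continuous (fun y => F y i k * G y k j)}.
  by apply: continuousM; [exact: Fc|exact: Gc].
exact: (continuousD (continuousD (FG i0) (FG i1)) (FG i2)).
Qed.

(** The path to [(t, Q)] is [t^s], together with [s] times the Euler angles of
[Q]. *)
Lemma connected_polar_domain : connected ([set t : R | 0 < t] `*` SO3 R).
Proof.
have SO31 : SO3 R 1%:M by split; [rewrite trmx1 mulmx1|rewrite det1].
apply: (@path_connected_connected R (R * 'M[R]_3)%type _ (1, 1%:M)) => [|[t Q] [/= t0 SQ]].
  by split => //=.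
have [a [b [c QE]]] := SO3_euler SQ.
have mulc (x : R) : continuous (fun s : R => s * x).
  by move=> s; apply: continuousM; [exact: cvg_id|exact: cst_continuous].
pose rot (s : R) : 'M[R]_3 := rotz (s * a) *m (rotx (s * b) *m rotz (s * c)).
have rotc : continuous rot.
  apply: continuous_mx => i j.
  have rz (x : R) i' j' : continuous (fun s : R => rotz (s * x) i' j').
    by move=> y; exact: (continuous_comp (mulc x y) (@rotz_continuous i' j' _)).
  have rx (x : R) i' j' : continuous (fun s : R => rotx (s * x) i' j').
    by move=> y; exact: (continuous_comp (mulc x y) (@rotx_continuous i' j' _)).
  by apply: continuous_mulmx3 => // i' j'; exact: continuous_mulmx3.
exists (fun s : R => (expR (s * ln t), rot s)); split=> [s|s||].
- exact: (cvg_pair (continuous_comp (mulc _ s) (@continuous_expR _ _)) (rotc s)).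
- split=> /=; first exact: expR_gt0.
  apply: SO3_mul (SO3_rotz _) _; exact: SO3_mul (SO3_rotx _) (SO3_rotz _).
- by rewrite /rot !mul0r expR0 rotz0 rotx0 !mulmx1.
- by rewrite /rot !mul1r lnK ?posrE // -QE.
Qed.

End Rotations.

Theorem proposition3p4 (R : realType) (q r : R) (hq : 0 <= q) (hr : 0 <= r) :
  diffeomorphic (Nqr q r) ([set t : R | 0 < t] `*` SO3 R) /\
  connected (Nqr q r).
Proof.
split.
  exists (to_polar q r), (of_polar q r); split.
  - exact: to_polar_bij.
  - by move=> a /set_mem; exact: to_polarK.
  - exact: to_polar_smooth.
  - exact: of_polar_smooth.
have -> : Nqr q r = of_polar q r @` ([set t : R | 0 < t] `*` SO3 R).
  apply/seteqP; split=> [a Na|_ [p pP <-]]; last exact: of_polarP.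
  by exists (to_polar q r a); [exact: to_polarP|exact: to_polarK].
apply: connected_continuous_connected; first exact: connected_polar_domain.
exact/smooth_map_within_continuous/of_polar_smooth.
Qed.
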